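(* There is an absolute constant $C$ (one may take $C=12$) such that the following holds. Let $d\geq 1$ be an integer, let $0\leq \alpha<d$, and let $1<p\le q<\infty$ satisfy $\frac1q=\frac1p-\frac{\alpha}{d}$. Put $p'=p/(p-1)$. Then for every weight $w$ on $\mathbb{R}^d$ in the class $A_{q/p'+1}$ and every locally integrable function $\varphi$ on $\mathbb{R}^d$, $$\|\mathcal{M}^\alpha\varphi\|_{L^q(w)}\leq C^d\inf_{1<r<q/p'+1}\left\{[w]_{A_r}^{1/(q-s)}\left(\frac{q}{s}\right)^{1/(q-s)}\right\}\|\varphi\|_{L^p(w^{p/q})},$$ where, for each $r$, $$s=s(r,p,\alpha)=q-\frac{rq^2}{(r-1)(q-p)+pq}.$$
   Context: A weight is a locally integrable, positive function $w$ on $\mathbb{R}^d$. All cubes have sides parallel to the coordinate axes and $|Q|$ is the Lebesgue measure of $Q$. For $1<r<\infty$, $$[w]_{A_r}=\sup_Q\left(\frac1{|Q|}\int_Q w\right)\left(\frac1{|Q|}\int_Q w^{-1/(r-1)}\right)^{r-1}\in[1,\infty],$$ the supremum being over all cubes $Q\subset\mathbb{R}^d$; $w\in A_r$ means $[w]_{A_r}<\infty$. Values of $r$ with $[w]_{A_r}=\infty$ contribute $+\infty$ to the infimum. For a positive function $\omega$, $\|\varphi\|_{L^p(\omega)}=\left(\int_{\mathbb{R}^d}|\varphi|^p\omega\,du\right)^{1/p}$ (possibly $+\infty$). The fractional maximal operator is $$\mathcal{M}^\alpha\varphi(x)=\sup\left\{|Q|^{\frac{\alpha}{d}-1}\int_Q|\varphi(u)|\,du: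 Q\subset\mathbb{R}^d\text{ is a cube containing }x\right\}.$$ *)

(* Defs.v *)
From HB Require Import structures.
From mathcomp Require Import all_boot all_order all_algebra.
From mathcomp Require Import all_classical all_reals all_analysis.

Set Implicit Arguments.
Unset Strict Implicit.
Unset Printing Implicit Defensive.

Import Order.TTheory GRing.Theory Num.Theory.
Import numFieldNormedType.Exports.

Local Open Scope classical_set_scope.
Local Open Scope ring_scope.
Local Open Scope ereal_scope.

Section tuple_cons.
Context {d : measure_display} {T : measurableType d} {n : nat}.

Definition tuple_cons (x : T * n.-tuple T) : n.+1.-tuple T :=
  [tuple of x.1 :: x.2].

Definition tuple_uncons (t : n.+1.-tuple T) : T * n.-tuple T :=
  (thead t, [tuple of behead t]).

Lemma tuple_consK : cancel tuple_cons tuple_uncons.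
Proof. by case=> x t; congr pair; exact: val_inj. Qed.

Lemma measurable_tuple_cons : measurable_fun [set: _] tuple_cons.
Proof. exact: measurable_cons. Qed.

Lemma measurable_tuple_uncons : measurable_fun [set: _] tuple_uncons.
Proof.
by apply: measurable_fun_pair; [exact: measurable_tnth|exact: measurable_behead].
Qed.

End tuple_cons.

Section measure_cons.
Context {d : measure_display} {T : measurableType d} {R : realType} {n : nat}.
Variables (m1 : {sigma_finite_measure set T -> \bar R})
          (m2 : {sigma_finite_measure set (n.-tuple T) -> \bar R}).

Definition measure_cons (A : set (n.+1.-tuple T)) : \bar R :=
  (m1 \x m2) (tuple_cons @^-1` A).

Let measurable_preimage_cons (A : set (n.+1.-tuple T)) :
  measurable A -> measurable (tuple_cons @^-1` A).
Proof.
by move=> mA; rewrite -[X in measurable X]setTI; exact: measurable_tuple_cons.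
Qed.

Let measure_cons0 : measure_cons set0 = 0.
Proof. by rewrite /measure_cons preimage_set0 measure0. Qed.

Let measure_cons_ge0 A : 0 <= measure_cons A.
Proof. exact: measure_ge0. Qed.

Let measure_cons_sigma_additive : semi_sigma_additive measure_cons.
Proof.
move=> F mF tF mUF; rewrite /measure_cons preimage_bigcup.
apply: measure_semi_sigma_additive.
- by move=> k; exact: measurable_preimage_cons.
- apply/trivIsetP => /= i j _ _ ij; rewrite -preimage_setI.
  by move/trivIsetP : tF => /(_ _ _ _ _ ij) ->//; rewrite preimage_set0.
- by rewrite -preimage_bigcup; exact: measurable_preimage_cons.
Qed.

HB.instance Definition _ := isMeasure.Build _ _ _ measure_cons
  measure_cons0 measure_cons_ge0 measure_cons_sigma_additive.

Let measure_cons_sigma_finite : sigma_finite [set: n.+1.-tuple T] measure_cons.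
Proof.
have /sigma_finiteP[F [TF ndF Foo]] := sigma_finiteT m1.
have /sigma_finiteP[G [TG ndG Goo]] := sigma_finiteT m2.
exists (fun k => tuple_uncons @^-1` (F k `*` G k)).
  rewrite -preimage_bigcup (_ : \bigcup_k _ = setT) ?preimage_setT//.
  apply/seteqP; split=> // -[x t] _.
  have [i _ Fx] : (\bigcup_k F k) x by rewrite -TF.
  have [j _ Gt] : (\bigcup_k G k) t by rewrite -TG.
  exists (maxn i j) => //; split => /=.
    by move: x Fx; exact/subsetPset/ndF/leq_maxl.
  by move: t Gt; exact/subsetPset/ndG/leq_maxr.
move=> k; have [mF Fk] := Foo k; have [mG Gk] := Goo k; split.
  rewrite -[X in measurable X]setTI; apply: measurable_tuple_uncons => //.
  exact: measurableX.
rewrite /measure_cons -comp_preimage (_ : _ \o _ = id) ?preimage_id//.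
  by rewrite product_measure1E// lte_mul_pinfty// ge0_fin_numE.
by apply/funext => x /=; rewrite tuple_consK.
Qed.

HB.instance Definition _ := Measure_isSigmaFinite.Build _ _ _ measure_cons
  measure_cons_sigma_finite.

End measure_cons.

(* The n-fold product of the one-dimensional Lebesgue measure, on the Borel
   sets. *)
Fixpoint product_lebesgue (R : realType) (n : nat) :
    {sigma_finite_measure set (n.-tuple (measurableTypeR R)) -> \bar R} :=
  match n with
  | 0 => \d_ [tuple]
  | n'.+1 => measure_cons (@lebesgue_measure R) (product_lebesgue R n')
  end.

(* R^d with the sigma-algebra of all Lebesgue measurable sets, obtained by
   Caratheodory completion of the product measure; its points are d-tuples. *)
Definition Rn (R : realType) (d : nat) : measurableType _ :=
  caratheodory_type (product_lebesgue R d)^*%mu.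

Definition lebesgue (R : realType) (d : nat) : set (Rn R d) -> \bar R :=
  @completed_measure_extension _ _ _ (product_lebesgue R d).

HB.instance Definition _ (R : realType) (d : nat) := Measure.on (@lebesgue R d).

Section weighted.
Context {R : realType} {d : nat}.
Implicit Types (Q : set (Rn R d)) (w phi : Rn R d -> R) (r : R).

Local Notation lambda := (@lebesgue R d).

Definition Rn_coord (x : Rn R d) (i : 'I_d) : R :=
  tnth (x : d.-tuple (measurableTypeR R)) i.

Definition to_rV (x : Rn R d) : 'rV[R]_d := \row_i Rn_coord x i.

(* The topology of R^d is the one of the row vectors. *)
Definition locally_integrable_Rn phi : Prop :=
  measurable_fun [set: Rn R d] phi /\
  forall K : set 'rV[R]_d, compact K ->
    \int[lambda]_(x in to_rV @^-1` K) `|phi x|%:E < +oo.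

Definition weight w : Prop :=
  locally_integrable_Rn w /\ forall x, (0 < w x)%R.

(* Closed axis-parallel cubes of positive side length. *)
Definition cube Q : Prop :=
  exists (a : Rn R d) (l : R), (0 < l)%R /\
    Q = [set x | forall i, (Rn_coord a i <= Rn_coord x i <= Rn_coord a i + l)%R].

Definition average Q (f : Rn R d -> R) : \bar R :=
  (lambda Q)^-1 * \int[lambda]_(u in Q) (f u)%:E.

Definition A_const r w : \bar R :=
  ereal_sup [set average Q w *
                 average Q (fun u => w u `^ (- (r - 1)^-1))%R `^ (r - 1)
            | Q in cube].

Definition wnorm (p : R) (w : Rn R d -> R) (f : Rn R d -> \bar R) : \bar R :=
  (\int[lambda]_u (`|f u| `^ p * (w u)%:E)) `^ p^-1.

Definition frac_maximal (alpha : R) phi (x : Rn R d) : \bar R :=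
  ereal_sup [set lambda Q `^ (alpha / d%:R - 1) *
                 \int[lambda]_(u in Q) `|phi u|%:E
            | Q in [set Q | cube Q /\ Q x]].

End weighted.

Definition s_exponent (R : realType) (p q r : R) : R :=
  (q - r * q ^+ 2 / ((r - 1) * (q - p) + p * q))%R.

(* Main.v *)
Require Import Defs.
From mathcomp Require Import all_boot all_order all_algebra.
From mathcomp Require Import all_classical all_reals all_analysis.
From mathcomp Require Import measurable_realfun ring lra.
Set Implicit Arguments.
Unset Strict Implicit.
Unset Printing Implicit Defensive.
Import Order.TTheory GRing.Theory Num.Theory.
Local Open Scope classical_set_scope.
Local Open Scope ring_scope.
Local Open Scope ereal_scope.

(** Put theta = alpha / d, P = q (1 - theta) = q / p' + 1, N the p-th power of
    the L^p(w^(p/q)) norm of phi, and psi = (|phi|^p w^(p/q - 1))^(1/P), so that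
    the integral of psi^P w is N. Hoelder's inequality on a cube Q gives
      |Q|^(theta - 1) int_Q |phi| <= N^theta (|Q|^-1 int_Q psi)^(1 - theta),
    so that the fractional operator on phi is controlled by the Hardy-Littlewood
    operator on psi in L^P(w). For 1 < r < P the latter is of weak type (r, r)
    with constant 3^d A_r^(1/r), by the Vitali covering lemma, and interpolation
    with L^oo gives its norm at most 2 (3^(dr) A_r P / (P - r))^(1/P). Passing to
    a countable family of rational cubes loses 2^d, and 2^d 3^d 2 <= 12^d. Finally
    P / (P - r) <= q / s and q - s <= q, while A_r and q / s are at least 1. *)

(** * Axis-parallel cubes *)

Section boxes.
Local Open Scope ring_scope.
Context {R : realType} {d : nat}.
Implicit Types (a x : Rn R d) (l : R).

Definition box a l : set (Rn R d) :=
  [set x | forall i, Rn_coord a i <= Rn_coord x i <= Rn_coord a i + l].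

Definition Rn_of (f : 'I_d -> R) : Rn R d := [tuple f i | i < d].

Lemma Rn_coord_of f i : Rn_coord (Rn_of f) i = f i.
Proof. by rewrite /Rn_coord tnth_mktuple. Qed.

Definition triple_box a l : set (Rn R d) :=
  box (Rn_of (fun i => Rn_coord a i - l)) (3 * l).

(** In each coordinate a point of the smaller cube is within [l1 <= l2] of the common point, and
    [triple_box] widens the larger cube by [l2] on both sides. *)
Lemma box_sub_triple {a1 a2 l1 l2} : l1 <= l2 ->
  box a1 l1 `&` box a2 l2 !=set0 -> box a1 l1 `<=` triple_box a2 l2.
Proof.
move=> l12 [z [z1 z2]] x x1 i; rewrite Rn_coord_of.
by move: (z1 i) (z2 i) (x1 i); lra.
Qed.

(** Greedy Vitali selection: keep a cube of largest side, discard every cube that meets it, all of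
    which lie in its triple, and recurse on the rest. *)
Lemma vitali_boxes (I : eqType) (a : I -> Rn R d) (l : I -> R) (s : seq I) :
  (forall i, 0 <= l i) ->
  exists D : seq I, [/\ uniq D, {subset D <= s},
    trivIset [set` D] (fun i => box (a i) (l i)) &
    forall i, i \in s -> exists2 j, j \in D &
      box (a i) (l i) `<=` triple_box (a j) (l j)].
Proof.
move=> l0; have [n] := ubnP (size s); elim: n s => // n IH [|i0 s'] sz.
  by exists [::]; split => // i j.
set s := i0 :: s' in sz *.
have [m ms mmax] : exists2 m, m \in s & forall i, i \in s -> l i <= l m.
  rewrite /s; elim: (s') (i0) => [|y t ih] y0.
    by exists y0; rewrite ?mem_head// => i; rewrite inE => /eqP ->.
  have [m mt mm] := ih y; have [h|/ltW h] := leP (l m) (l y0).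
    exists y0; rewrite ?mem_head// => i; rewrite inE => /predU1P[->//|it].
    exact: le_trans (mm _ it) h.
  exists m; first by rewrite inE mt orbT.
  by move=> i; rewrite inE => /predU1P[->//|]; exact: mm.
pose B i := box (a i) (l i).
have mB i : B i `&` B i !=set0.
  by exists (a i); split => k; rewrite lexx lerDl l0.
pose t := [seq i <- s | ~~ `[< B i `&` B m !=set0 >]].
(* [B m] is nonempty, so [m] itself is filtered out and [t] is strictly shorter than [s]. *)
have tsz : (size t < n)%N.
  rewrite -ltnS (leq_trans _ sz)// ltnS size_filter -(count_predC (fun i => ~~ `[< B i `&` B m !=set0 >]) s).
  rewrite -addn1 leq_add2l -has_count; apply/hasP; exists m => //=.
  by rewrite negbK; apply/asboolP.
have [D [uD Dt trD covD]] := IH t tsz.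
have tP i : i \in t -> (i \in s) /\ ~ (B i `&` B m !=set0).
  by rewrite mem_filter => /andP[/asboolPn].
exists (m :: D); split.
- rewrite /= uD andbT; apply/negP => /Dt/tP[_]; exact.
- by move=> i; rewrite inE => /predU1P[->//|/Dt/tP[]].
- move=> i j /=; rewrite !inE => /predU1P[->|iD] /predU1P[->|jD] //.
  + by move=> h; have [_ []] := tP _ (Dt _ jD); rewrite setIC.
  + by move=> h; have [_ []] := tP _ (Dt _ iD).
  + exact: trD.
- move=> i is_; have [h|h] := pselect (B i `&` B m !=set0).
    by exists m; rewrite ?mem_head//; apply: box_sub_triple => //; exact: mmax.
  have [|j jD ij] := covD i.
    by rewrite mem_filter is_ andbT; apply/asboolPn.
  by exists j => //; rewrite inE jD orbT.
Qed.

End boxes.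

(** * Lebesgue measure of cubes *)

Section lebesgue_boxes.
Local Open Scope ring_scope.
Context {R : realType}.

(** The same cube as [box], typed in the Borel tuple space that carries [product_lebesgue] before
    completion. *)
Definition pbox (n : nat) (a : 'I_n -> R) (l : R) : set (n.-tuple (measurableTypeR R)) :=
  [set x | forall i, a i <= tnth x i <= a i + l].

Lemma measurable_pbox n a l : measurable (@pbox n a l).
Proof.
have -> : pbox a l = \bigcap_(i in [set: 'I_n])
    ((fun x : n.-tuple (measurableTypeR R) => tnth x i) @^-1` `[a i, a i + l]).
  apply/seteqP; split => x /= H i.
    by move=> _; rewrite /= in_itv/= H.
  by have := H i I; rewrite /= in_itv.
apply: fin_bigcap_measurable => // i _.
rewrite -[X in measurable X]setTI.
by apply: measurable_tnth => //; exact: measurable_itv.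
Qed.

(** Induction on the dimension: along [tuple_cons] the cube splits into an interval times a cube of
    one dimension less. *)
Lemma product_lebesgue_pbox n a l : 0 <= l ->
  product_lebesgue R n (@pbox n a l) = (l ^+ n)%:E.
Proof.
move=> l0; elim: n a => [|n IH] a.
  rewrite /= (_ : pbox _ _ = setT) ?expr0; last first.
    by apply/seteqP; split => // x _ [].
  by rewrite diracT.
rewrite /= /measure_cons.
rewrite (_ : _ @^-1` _ = `[a ord0, a ord0 + l] `*` pbox (fun i => a (lift ord0 i)) l); last first.
  apply/seteqP; split => -[x t] /=.
    move=> H; split; first by have := H ord0; rewrite in_itv.
    by move=> i; have := H (lift ord0 i); rewrite tnthS.
  rewrite in_itv /= => -[h1 h2] i.
  by case: (unliftP ord0 i) => [j ->|->//]; rewrite tnthS; exact: h2.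
rewrite product_measure1E//; last exact: measurable_pbox.
rewrite IH exprS EFinM; congr (_ * _)%E.
apply: (eq_trans (lebesgue_measure_itv `[a ord0, a ord0 + l])) => /=.
rewrite lte_fin ltrDl; case: ltP => l1.
  by rewrite -EFinD addrAC subrr add0r.
by congr EFin; apply/eqP; rewrite eq_le l1 l0.
Qed.

Lemma measurable_box d (a : Rn R d) l : measurable (box a l).
Proof.
by apply: caratheodory_measurable_mu_ext; exact: measurable_pbox.
Qed.

Lemma lebesgue_box d (a : Rn R d) l : 0 <= l -> lebesgue (box a l) = (l ^+ d)%:E.
Proof.
move=> l0; rewrite /lebesgue /completed_measure_extension measurable_mu_extE.
  exact: product_lebesgue_pbox.
exact: measurable_pbox.
Qed.

End lebesgue_boxes.

(** * Integrals of nonnegative functions *)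

Section integrals.
Context d (T : measurableType d) (R : realType).
Variable mu : {measure set T -> \bar R}.

(* No measurability: the integral of a nonnegative function is a supremum over
   the simple functions below it. *)
Lemma ge0_le_integralT (f g : T -> \bar R) :
  (forall x, 0 <= f x) -> (forall x, f x <= g x) ->
  \int[mu]_x f x <= \int[mu]_x g x.
Proof.
move=> f0 fg; rewrite !ge0_integralTE//; last first.
  by move=> x; exact: le_trans (fg x).
by apply: le_ereal_sup => _ [h hf <-]; exists h => // x; exact: le_trans (fg x).
Qed.

(** Hoelder's inequality for the conjugate exponents 1/t and 1/(1 - t). Parametrised by t it
    includes the endpoints, and t = 0 serves the case alpha = 0. *)
Lemma ge0_integral_hoelder (D : set T) (f g : T -> R) (t : R) :
  measurable D -> measurable_fun setT f -> measurable_fun setT g ->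
  (forall x, 0 <= f x)%R -> (forall x, 0 <= g x)%R -> (0 <= t <= 1)%R ->
  \int[mu]_(x in D) (f x `^ t * g x `^ (1 - t))%:E <=
  (\int[mu]_(x in D) (f x)%:E) `^ t * (\int[mu]_(x in D) (g x)%:E) `^ (1 - t).
Proof.
move=> mD mf mg f0 g0 /andP[t0 t1].
(* At the endpoints one conjugate exponent would be infinite; as a zeroth power is 1, even at 0 and
   [+oo], both sides coincide. *)
have [->|tn0] := eqVneq t 0%R.
  rewrite subr0 poweRe0 mul1e poweRe1; last first.
    by apply: integral_ge0 => x _; rewrite lee_fin.
  by under eq_integral do rewrite powRr0 mul1r powRr1//.
have [->|tn1] := eqVneq t 1%R.
  rewrite subrr poweRe0 mule1 poweRe1; last first.
    by apply: integral_ge0 => x _; rewrite lee_fin.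
  by under eq_integral do rewrite powRr0 mulr1 powRr1//.
have {t0 tn0}t0 : (0 < t)%R by rewrite lt_neqAle eq_sym tn0.
have {t1 tn1}t1 : (0 < 1 - t)%R by rewrite subr_gt0 lt_neqAle tn1.
have mP (h : T -> R) s : measurable_fun setT h ->
    measurable_fun setT (fun x => h x `^ s * \1_D x)%R.
  move=> mh; apply: measurable_funM.
    exact: (measurableT_comp (measurable_powR s)).
  exact: measurable_indic.
have := hoelder mu (mP f t mf) (mP g (1 - t)%R mg)
  (p := t^-1) (q := (1 - t)^-1).
rewrite !invr_gt0 t0 t1 !invrK => /(_ isT isT).
rewrite addrC subrK => /(_ erefl).
rewrite Lnorm1 => H; apply: le_trans (le_trans _ H) _.
  rewrite integral_mkcond; apply: ge0_le_integralT.
    by apply: erestrict_ge0 => x _; rewrite lee_fin mulr_ge0 ?powR_ge0.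
  move=> x; rewrite patchE; case: ifPn => [xD|_] /=; last by rewrite lee_fin.
  by rewrite lee_fin ger0_norm ?mulr_ge0 ?powR_ge0// indicE xD !mulr1.
have LE (h : T -> R) s : (0 < s)%R -> (forall x, 0 <= h x)%R ->
   'N[mu]_(s^-1)%:E[EFin \o (fun x => h x `^ s * \1_D x)%R] =
   (\int[mu]_(x in D) (h x)%:E) `^ s.
  move=> s0 h0; rewrite unlock /= invrK; congr (_ `^ _).
  rewrite [RHS]integral_mkcond; apply: eq_integral => x _ /=.
  rewrite patchE ger0_norm ?mulr_ge0 ?powR_ge0// indicE.
  case: (x \in D); last by rewrite mulr0 powR0// invr_neq0 ?gt_eqF.
  by rewrite mulr1 -powRrM divff ?gt_eqF// powRr1.
by rewrite !LE.
Qed.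

Lemma measurable_fun_truncation (f g : T -> R) (t : R) :
  measurable_fun setT f -> measurable_fun setT g ->
  measurable_fun setT (fun x => if (t <= f x)%R then g x else 0%R).
Proof.
by move=> mf mg; apply: measurable_fun_ifT => //; exact: measurable_fun_ler.
Qed.

Lemma measurable_fun_powRM (f g : T -> R) (r : R) :
  measurable_fun setT f -> measurable_fun setT g ->
  measurable_fun setT (fun x => f x `^ r * g x)%R.
Proof.
move=> mf mg; apply: measurable_funM => //.
exact: (measurableT_comp (measurable_powR r)).
Qed.

Lemma measurable_fun_max_indic (f : T -> R) (c : R) (B : set T) :
  measurable_fun setT f -> measurable B ->
  measurable_fun setT (fun x => Order.max (f x) (c * \1_B x))%R.
Proof.
move=> mf mB; apply: measurable_maxr => //; apply: measurable_funM => //.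
Qed.

Lemma measurable_funMl (f : T -> R) (c : R) :
  measurable_fun setT f -> measurable_fun setT (fun x => c * f x)%R.
Proof. by move=> mf; apply: measurable_funM. Qed.

(** The points where [2 * f x < t] contribute at most [t / 2 * m], half of [t * m], so the other
    half comes from the remaining points. *)
Lemma integral_truncation (B : set T) (f : T -> R) (t m : R) :
  measurable B -> mu B = m%:E ->
  measurable_fun setT f -> (forall x, 0 <= f x)%R -> (0 <= t)%R ->
  (t * m)%:E <= \int[mu]_(x in B) (f x)%:E ->
  (t / 2 * m)%:E <=
    \int[mu]_(x in B) (if (t <= 2 * f x)%R then f x else 0%R)%:E.
Proof.
move=> mB Bm mf f0 t0 tf.
have mtr := measurable_fun_truncation t (measurable_funMl 2 mf) mf.
have : (t * m)%:E <= \int[mu]_(x in B)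
    (if (t <= 2 * f x)%R then f x else 0%R)%:E + (t / 2 * m)%:E.
  have -> : (t / 2 * m)%:E = \int[mu]_(x in B) cst (t / 2)%:E x.
    by rewrite integral_cst//= Bm EFinM.
  rewrite -ge0_integralD//; last 3 first.
  - by move=> x _; case: ifP => _; rewrite lee_fin.
  - by apply/measurable_EFinP; exact: measurable_funTS.
  - by move=> x _; rewrite lee_fin divr_ge0.
  apply: le_trans tf _; apply: ge0_le_integral => //.
  - by move=> x _; rewrite lee_fin.
  - by apply/measurable_EFinP; exact: measurable_funTS.
  - apply: emeasurable_funD => //.
    by apply/measurable_EFinP; exact: measurable_funTS.
  - move=> x _; rewrite /cst -EFinD lee_fin; case: ifPn => h.
      by rewrite lerDl divr_ge0.
    by rewrite add0r ler_pdivlMr// mulrC ltW// ltNge.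
rewrite -leeBlDr// -EFinB; congr (_ <= _); congr EFin.
by rewrite -mulrBl {1}(splitr t) addrK.
Qed.

Lemma integral_cover (I : eqType) (s : seq I) (B : I -> set T) (f : T -> R)
    (b : T -> bool) :
  measurable_fun setT f -> (forall x, 0 <= f x)%R ->
  (forall i, measurable (B i)) ->
  (forall x, b x -> exists2 i, i \in s & B i x) ->
  \int[mu]_x (if b x then f x else 0%R)%:E <=
    \sum_(i <- s) \int[mu]_(x in B i) (f x)%:E.
Proof.
move=> mf f0 mB bs.
have -> : \sum_(i <- s) \int[mu]_(x in B i) (f x)%:E =
    \int[mu]_x \sum_(i <- s) ((EFin \o f) \_ (B i)) x.
  rewrite ge0_integral_sum//.
  - by apply: eq_bigr => j _; rewrite integral_mkcond.
  - move=> j; apply/(measurable_restrictT _ _).1 => //.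
    by apply/measurable_EFinP; exact: measurable_funTS.
  - by move=> j x _; apply: erestrict_ge0 => y _; rewrite lee_fin.
have S0 j x : 0 <= ((EFin \o f) \_ (B j)) x.
  by apply: erestrict_ge0 => y _; rewrite lee_fin.
apply: ge0_le_integralT => x; first by case: ifP; rewrite lee_fin.
case: ifPn => [/bs[i si xi]|_]; last by rewrite sume_ge0.
rewrite (big_rem i)//= patchE mem_set//.
by rewrite leeDl// sume_ge0.
Qed.

Lemma sum_integral_disjoint (I : eqType) (s : seq I) (B : I -> set T)
    (f : T -> R) :
  measurable_fun setT f -> (forall x, 0 <= f x)%R ->
  (forall i, measurable (B i)) -> uniq s -> trivIset [set` s] B ->
  \sum_(i <- s) \int[mu]_(x in B i) (f x)%:E <= \int[mu]_x (f x)%:E.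
Proof.
move=> mf f0 mB us tB.
have mf' E : measurable_fun E (EFin \o f).
  by apply/measurable_EFinP; exact: measurable_funTS.
rewrite -(ge0_integral_bigsetU mu mB us tB)//; last first.
  by move=> x _; rewrite lee_fin.
apply: ge0_subset_integral => //.
  by apply: bigsetU_measurable => i _; exact: mB.
by move=> x _; rewrite lee_fin.
Qed.

(** Monotone convergence; it carries bounds uniform in n from finitely many cubes to countably
    many. *)
Lemma integral_sup_le (f : nat -> T -> R) (M : \bar R) :
  (forall n, measurable_fun setT (f n)) -> (forall n x, 0 <= f n x)%R ->
  (forall x, {homo f^~ x : m n / (m <= n)%N >-> (m <= n)%R}) ->
  (forall n, \int[mu]_x (f n x)%:E <= M) ->
  \int[mu]_x ereal_sup (range (fun n => (f n x)%:E)) <= M.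
Proof.
move=> mf f0 ndf fM.
have -> : \int[mu]_x ereal_sup (range (fun n => (f n x)%:E)) =
    \int[mu]_x limn (fun n => (f n x)%:E).
  apply: eq_integral => x _; apply/esym/cvg_lim => //.
  by apply: ereal_nondecreasing_cvgn => m n mn; rewrite lee_fin ndf.
rewrite (monotone_convergence mu measurableT (g' := fun n x => (f n x)%:E)).
- apply: lime_le; last exact: nearW.
  apply: ereal_nondecreasing_is_cvgn => m n mn.
  apply: ge0_le_integralT => x; first by rewrite lee_fin.
  by rewrite lee_fin ndf.
- by move=> n; exact/measurable_EFinP.
- by move=> n x _; rewrite lee_fin.
- by move=> x _ m n mn; rewrite lee_fin ndf.
Qed.

End integrals.

(** * Muckenhoupt weights *)

Section muckenhoupt.
Context {R : realType} {d : nat}.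
Implicit Types (a : Rn R d) (l r : R) (w psi : Rn R d -> R).
Local Notation lambda := (@lebesgue R d).

(** The exponent equals 1 - r', where r' = r / (r - 1) is conjugate to r. *)
Definition dual_weight r w : Rn R d -> R := (fun u => w u `^ (- (r - 1)^-1))%R.

Lemma measurable_dual_weight r w :
  measurable_fun setT w -> measurable_fun setT (dual_weight r w).
Proof. by move=> mw; exact: (measurableT_comp (measurable_powR _)). Qed.

(** Hoelder with t = 1/r for psi = (psi^r w)^(1/r) (dual weight)^(1 - 1/r), then raised to the power
    r. *)
Lemma integral_box_hoelder r w psi (B : set (Rn R d)) : (1 < r)%R ->
  measurable B ->
  measurable_fun setT w -> (forall x, 0 < w x)%R ->
  measurable_fun setT psi -> (forall x, 0 <= psi x)%R ->
  (\int[lambda]_(x in B) (psi x)%:E) `^ r <=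
  \int[lambda]_(x in B) (psi x `^ r * w x)%:E *
  (\int[lambda]_(x in B) (dual_weight r w x)%:E) `^ (r - 1).
Proof.
move=> r1 mB mw w0 mpsi psi0.
have r0 : (0 < r)%R by rewrite (lt_trans _ r1).
have r10 : (0 < r - 1)%R by rewrite subr_gt0.
have rV : (0 <= r^-1 <= 1)%R by rewrite invr_ge0 (ltW r0) invf_le1// ltW.
have i0 (f : Rn R d -> R) : (forall x, 0 <= f x)%R ->
  0 <= \int[lambda]_(x in B) (f x)%:E.
  by move=> f0; apply: integral_ge0 => x _; rewrite lee_fin.
have mf := measurable_fun_powRM r mpsi mw.
have f0 x : (0 <= psi x `^ r * w x)%R by rewrite mulr_ge0 ?powR_ge0// ltW.
have := ge0_integral_hoelder lambda mB mf (measurable_dual_weight r mw) f0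
  (fun x => powR_ge0 _ _) rV.
have -> : \int[lambda]_(x in B)
    ((psi x `^ r * w x) `^ r^-1 * dual_weight r w x `^ (1 - r^-1))%:E =
    \int[lambda]_(x in B) (psi x)%:E.
  apply: eq_integral => x _; congr EFin.
  rewrite powRM ?powR_ge0//; last exact: ltW.
  rewrite -!powRrM divff ?gt_eqF// powRr1// -mulrA -powRD.
    rewrite (_ : _ + _ = 0)%R ?powRr0 ?mulr1//.
    by field; rewrite !gt_eqF.
  by rewrite (gt_eqF (w0 x)) implybT.
set I := \int[_]_(x in B) (psi x)%:E; set F := \int[_]_(x in B) _;
  set S := \int[_]_(x in B) _ => H.
have S0 : 0 <= S by apply: i0 => x; exact: powR_ge0.
have F0 : 0 <= F by apply: i0.
have /(gt0_ler_poweR (ltW r0)) : I <= F `^ r^-1 * S `^ (1 - r^-1) by [].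
rewrite poweRM ?poweR_ge0// -!poweRrM mulVf ?gt_eqF// poweRe1//.
rewrite mulrBl mul1r mulVf ?gt_eqF//.
by apply; rewrite in_itv/= leey andbT ?mule_ge0 ?poweR_ge0// i0.
Qed.

(** The two averages bring |Q|^(-1) and |Q|^(-(r - 1)); clearing both denominators leaves |Q|^r on
    the right. *)
Lemma A_const_box r w a l : (0 < l)%R -> (1 < r)%R ->
  \int[lambda]_(x in box a l) (w x)%:E *
  (\int[lambda]_(x in box a l) (dual_weight r w x)%:E) `^ (r - 1) <=
  A_const r w * ((l ^+ d) `^ r)%:E.
Proof.
move=> l0 r1.
have ld0 : (0 < l ^+ d)%R by rewrite exprn_gt0.
have : average (box a l) w * average (box a l) (dual_weight r w) `^ (r - 1) <=
    A_const r w.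
  by apply: ereal_sup_ubound => /=; exists (box a l) => //; exists a, l.
rewrite /average lebesgue_box ?(ltW l0)//.
rewrite inver gt_eqF//.
set W := \int[_]_(x in _) _; set S := \int[_]_(x in _) _.
have S0 : 0 <= S by apply: integral_ge0 => x _; rewrite lee_fin powR_ge0.
rewrite poweRM ?lee_fin ?invr_ge0 ?(ltW ld0)// poweR_EFin.
rewrite -(@lee_pmul2r _ ((l ^+ d) `^ r)%:E) ?lte_fin ?powR_gt0//.
apply: le_trans.
rewrite muleACA muleAC -!EFinM -(powR_inv1 (ltW ld0)) -powRrM mulN1r.
rewrite -!powRD; try by rewrite (gt_eqF ld0) implybT.
by rewrite (_ : _ + _ + _ = 0)%R ?powRr0 ?mul1e//; ring.
Qed.

(** On the unit cube, Hoelder for psi = 1 bounds 1 by the product in the A_r condition. *)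
Lemma A_const_ge1 r w : (1 < r)%R ->
  measurable_fun setT w -> (forall x, 0 < w x)%R -> 1 <= A_const r w.
Proof.
move=> r1 mw w0.
have := A_const_box w (Rn_of (fun=> 0%R)) ltr01 r1.
rewrite expr1n powR1 mule1; apply: le_trans.
have mB := measurable_box (Rn_of (fun=> 0%R) : Rn R d) 1.
have := integral_box_hoelder r1 mB mw w0 (psi := cst 1%R)
  (measurable_cst _) (fun=> ler01).
rewrite (integral_cst lambda mB 1) mul1e/= lebesgue_box// expr1n poweR1r.
move=> /le_trans; apply; rewrite le_eqVlt; apply/orP; left; apply/eqP.
by congr (_ * _); apply: eq_integral => x _; rewrite powR1 mul1r.
Qed.

(* Bounding the dual weight on the cube by the dual weight on its triple applies
   the A_r condition once, on the triple; comparing the [w]-masses of the two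
   cubes by doubling would cost a second factor [A_const r w]. *)
Lemma A_const_test r w psi a l c : (0 < l)%R -> (1 < r)%R ->
  measurable_fun setT w -> (forall x, 0 < w x)%R ->
  measurable_fun setT psi -> (forall x, 0 <= psi x)%R ->
  (0 <= c)%R ->
  (c * l ^+ d)%:E <= \int[lambda]_(x in box a l) (psi x)%:E ->
  \int[lambda]_(x in triple_box a l) (w x)%:E * (c `^ r)%:E <=
  A_const r w * ((3 ^+ d) `^ r)%:E * \int[lambda]_(x in box a l) (psi x `^ r * w x)%:E.
Proof.
move=> l0 r1 mw w0 mpsi psi0 c0 cI.
have ld0 : (0 < l ^+ d)%R by rewrite exprn_gt0.
have l30 : (0 < 3 * l)%R by rewrite mulr_gt0.
have r0 : (0 <= r)%R by rewrite ltW// (lt_trans _ r1).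
have mB := measurable_box a l.
have m3B : measurable (triple_box a l) by exact: measurable_box.
have h1 := A_const_box w (Rn_of (fun i => Rn_coord a i - l)%R) l30 r1.
have h2 := integral_box_hoelder r1 mB mw w0 mpsi psi0.
have h3 : \int[lambda]_(x in box a l) (dual_weight r w x)%:E <=
   \int[lambda]_(x in triple_box a l) (dual_weight r w x)%:E.
  apply: (ge0_subset_integral lambda mB m3B).
  - apply/measurable_EFinP; apply: measurable_funTS.
    exact: measurable_dual_weight.
  - by move=> x _; rewrite lee_fin powR_ge0.
  - by apply: box_sub_triple => //; exists a; split => i; rewrite lexx lerDl ltW.
rewrite -/(triple_box a l) in h1.
have A0 : 0 <= A_const r w by rewrite (le_trans _ (A_const_ge1 r1 mw w0)).
move: h1 h2 h3 cI.
set W := \int[_]_(x in triple_box a l) (w x)%:E.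
set S := \int[_]_(x in box a l) (dual_weight r w x)%:E.
set S3 := \int[_]_(x in triple_box a l) (dual_weight r w x)%:E.
set I := \int[_]_(x in box a l) (psi x)%:E.
set F := \int[_]_(x in box a l) _.
have W0 : 0 <= W by apply: integral_ge0 => x _; rewrite lee_fin ltW.
have S0 : 0 <= S by apply: integral_ge0 => x _; rewrite lee_fin powR_ge0.
have F0 : 0 <= F.
  by apply: integral_ge0 => x _; rewrite lee_fin mulr_ge0 ?powR_ge0// ltW.
move=> h1 h2 h3 cI.
(* With |Q|^r on both sides, [c] turns into the mass [c * l ^+ d], which the integral of psi
   dominates. *)
rewrite -(@lee_pmul2r _ ((l ^+ d) `^ r)%:E) ?lte_fin ?powR_gt0//.
rewrite -muleA -EFinM -powRM// ?(ltW ld0)//.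
(* Hoelder on the cube, with the dual weight enlarged to the triple, gives the first inequality; the
   A_r condition on the triple, with |3Q|^r = (3^d)^r |Q|^r, gives the second. *)
apply: (@le_trans _ _ (W * (F * S3 `^ (r - 1)))).
  apply: lee_wpmul2l => //.
  rewrite -poweR_EFin; apply: le_trans (le_trans h2 _).
    apply: gt0_ler_poweR => //; rewrite in_itv/= leey andbT.
      by rewrite lee_fin mulr_ge0// ltW.
    by apply: le_trans cI; rewrite lee_fin mulr_ge0// ltW.
  apply: lee_wpmul2l => //; apply: gt0_ler_poweR => //.
  - by rewrite subr_ge0 ltW.
  - by rewrite in_itv/= leey andbT.
  - by rewrite in_itv/= leey andbT (le_trans S0).
rewrite muleCA muleC -[leRHS]muleA [X in _ <= _ * X]muleC muleA.
apply: lee_wpmul2r => //.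
by rewrite -muleA -EFinM -powRM ?exprn_ge0// ?(ltW l0)// -exprMn.
Qed.

End muckenhoupt.

(** * Interpolation *)

Section interpolation.
Local Open Scope ring_scope.
Context {R : realType}.
Implicit Types (x y p r : R).

(** Young's inequality bounds x^(p - r) y^r by (p - r)/p x^p + r/p y^p. The result is a discrete
    form of d(t^p) = p/(p - r) t^r d(t^(p - r)). *)
Lemma powR_diff_le x y p r : 0 <= x -> 0 <= y -> 0 < r -> r < p ->
  y `^ p - x `^ p <= p / (p - r) * (y `^ r * (y `^ (p - r) - x `^ (p - r))).
Proof.
move=> x0 y0 r0 rp.
have p0 : 0 < p by exact: lt_trans rp.
have pr0 : 0 < p - r by rewrite subr_gt0.
have := @conjugate_powR R (x `^ (p - r)) (y `^ r) (p / (p - r)) (p / r)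
  (powR_ge0 _ _) (powR_ge0 _ _).
rewrite !divr_gt0// => /(_ isT isT).
rewrite !invf_div -mulrDl subrK divff ?gt_eqF// => /(_ erefl).
rewrite -!powRrM !(mulrC _ (p / _)) !divfK ?gt_eqF// => H.
rewrite mulrBr -powRD ?(addrC r) ?subrK; last by rewrite gt_eqF.
rewrite -(@ler_pM2l _ ((p - r) / p)) ?divr_gt0// mulrA.
rewrite (_ : (p - r) / p * (p / (p - r)) = 1) ?mul1r; last first.
  by field; rewrite !gt_eqF.
move: H; set X := x `^ p; set Y := y `^ p; rewrite (mulrC (y `^ r)) => H.
have -> : (p - r) / p * (Y - X) = Y - (X * ((p - r) / p) + Y * (r / p)).
  by field; rewrite gt_eqF.
by rewrite lerD2l lerN2.
Qed.

Section telescope.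
Variables (F : R -> R) (u : nat -> R) (m : nat).
Hypothesis F0 : F 0 = 0.
Hypothesis ndF : forall x y, 0 <= x -> x <= y -> F x <= F y.
Hypothesis u0 : u 0%N = 0.
Hypothesis ndu : forall i j, (i <= j <= m)%N -> u i <= u j.

Let u_ge0 i : (i <= m)%N -> 0 <= u i.
Proof. by move=> im; rewrite -u0 ndu. Qed.

Let dF_ge0 k : (k < m)%N -> 0 <= F (u k.+1) - F (u k).
Proof.
by move=> km; rewrite subr_ge0 ndF ?u_ge0 ?(ltnW km)// ndu// leqnSn.
Qed.

(** Discrete layer-cake formula at a level: the increments of index below [j] telescope to
    [F (u j)], and the later terms are nonnegative. *)
Lemma telescope_ge j : (j <= m)%N ->
  F (u j) <= \sum_(k < m) (if u k.+1 <= u j then F (u k.+1) - F (u k) else 0).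
Proof.
move=> jm.
have -> : F (u j) = \sum_(0 <= k < j) (F (u k.+1) - F (u k)).
  by rewrite telescope_sumr// u0 F0 subr0.
rewrite -(big_mkord xpredT (fun k => if u k.+1 <= u j then F (u k.+1) - F (u k) else 0)).
rewrite [leRHS](big_cat_nat (n := j))//=; apply: ler_wpDr.
  rewrite big_nat; apply: sumr_ge0 => k /andP[_ km].
  by case: ifPn => // _; exact: dF_ge0.
rewrite big_nat [leRHS]big_nat; apply: ler_sum => k /andP[_ kj].
by rewrite ndu// kj jm.
Qed.

(** Here [z] need not be a level: the sum telescopes to the last level not above [z], where
    monotonicity of [F] takes over. *)
Lemma telescope_le z : 0 <= z ->
  \sum_(k < m) (if u k.+1 <= z then F (u k.+1) - F (u k) else 0) <= F z.
Proof.
move=> z0.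
suff H n : (n <= m)%N -> \sum_(k < n) (if u k.+1 <= z then F (u k.+1) - F (u k) else 0) <= F z.
  exact: H.
elim: n => [_|n IH nm]; first by rewrite big_ord0 -F0 ndF.
rewrite big_ord_recr/=; case: ifPn => [unz|_]; last by rewrite addr0 IH// ltnW.
apply: (@le_trans _ _ (F (u n.+1))); last by rewrite ndF// u_ge0.
rewrite [leRHS](_ : _ = \sum_(k < n.+1) (F (u k.+1) - F (u k))); last first.
  rewrite -(big_mkord xpredT (fun k => F (u k.+1) - F (u k))).
  by rewrite telescope_sumr// u0 F0 subr0.
rewrite [leRHS]big_ord_recr/= lerD2r; apply: ler_sum => k _.
case: ifPn => // _; apply: dF_ge0; exact: leq_trans (ltn_ord k) (ltnW nm).
Qed.

End telescope.
End interpolation.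

(** * From weak type to strong type *)

Section interpolation_integral.
Context d (T : measurableType d) (R : realType).
Variable mu : {measure set T -> \bar R}.

(* As [h] takes finitely many values [u k], the layer-cake integral is a
   finite sum, and [powR_diff_le] trades increments of the power [p] for
   increments of the power [p - r]. *)
Lemma weak_type_interpolation (w psi h : T -> R) (s : seq R) (r p : R)
    (K : \bar R) :
  measurable_fun setT w -> measurable_fun setT psi -> measurable_fun setT h ->
  (forall x, 0 <= w x)%R -> (forall x, 0 <= psi x)%R ->
  (forall x, 0 <= h x)%R -> (forall x, h x \in 0%R :: s) ->
  (0 < r)%R -> (r < p)%R -> 0 <= K ->
  (forall t, (0 < t)%R ->
     \int[mu]_x (if (t <= h x)%R then w x else 0%R)%:E * ((t / 2) `^ r)%:E <=
     K * \int[mu]_x (if (t <= 2 * psi x)%R then psi x `^ r * w x else 0)%R%:E) ->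
  \int[mu]_x (h x `^ p * w x)%:E <=
  K * (2 `^ p * (p / (p - r)))%:E * \int[mu]_x (psi x `^ p * w x)%:E.
Proof.
move=> mw mpsi mh w0 psi0 h0 hs r0 rp K0 weak.
have p0 : (0 < p)%R by exact: lt_trans rp.
have pr0 : (0 < p - r)%R by rewrite subr_gt0.
(* The levels are 0 followed by the positive entries of [s] in increasing order; a repeated entry
   gives a zero increment. *)
pose ts := sort <=%R [seq y <- s | 0 < y]%R.
pose m := size ts; pose u := nth 0%R (0%R :: ts).
have ts0 y : y \in ts -> (0 < y)%R by rewrite mem_sort mem_filter => /andP[].
have u_gt0 k : (k < m)%N -> (0 < u k.+1)%R by move=> km; apply/ts0/mem_nth.
have sorted_u : sorted <=%R (0%R :: ts).
  rewrite /= path_min_sorted ?sort_le_sorted//.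
  by apply/allP => y /ts0/ltW.
have ndu i j : (i <= j <= m)%N -> (u i <= u j)%R.
  move=> /andP[ij jm]; apply: (sorted_leq_nth le_trans lexx) => //.
  by rewrite inE/= ltnS (leq_trans ij).
have hu x : exists2 j, (j <= m)%N & h x = u j.
  exists (index (h x) (0%R :: ts)).
    rewrite -ltnS -[m.+1]/(size (0%R :: ts)) index_mem.
    move: (hs x); rewrite !inE => /predU1P[->|hxs]; first by rewrite eqxx.
    have := h0 x; rewrite le_eqVlt eq_sym => /predU1P[->|hx0].
      by rewrite eqxx.
    by rewrite mem_sort mem_filter hx0 hxs orbT.
  rewrite /u nth_index//.
  move: (hs x); rewrite !inE => /predU1P[->|hxs]; first by rewrite eqxx.
  have := h0 x; rewrite le_eqVlt eq_sym => /predU1P[->|hx0].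
    by rewrite eqxx.
  by rewrite mem_sort mem_filter hx0 hxs orbT.
pose a k : R := (u k.+1 `^ p - u k `^ p)%R.
pose b k : R := (u k.+1 `^ (p - r) - u k `^ (p - r))%R.
have pow0 q : (0 < q)%R -> (0 `^ q = 0 :> R)%R.
  by move=> q0; rewrite powR0 ?gt_eqF.
have powle (q : R) : (0 < q)%R ->
    forall x y : R, (0 <= x -> x <= y -> x `^ q <= y `^ q)%R.
  move=> q0 x y x0 xy; apply: ge0_ler_powR; rewrite ?nnegrE ?(ltW q0)//.
  exact: le_trans xy.
have u_ge0 k : (k <= m)%N -> (0 <= u k)%R by move=> km; apply: (ndu 0%N).
have a0 k : (k < m)%N -> (0 <= a k)%R.
  move=> km; rewrite subr_ge0 powle ?u_ge0 ?(ltnW km)// ndu// leqnSn//.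
have b0 k : (k < m)%N -> (0 <= b k)%R.
  move=> km; rewrite subr_ge0 powle ?u_ge0 ?(ltnW km)// ndu// leqnSn//.
pose W k x : R := if (u k.+1 <= h x)%R then w x else 0%R.
pose P k x : R := if (u k.+1 <= 2 * psi x)%R then (psi x `^ r * w x)%R else 0%R.
have W0 k x : (0 <= W k x)%R by rewrite /W; case: ifPn.
have P0 k x : (0 <= P k x)%R.
  by rewrite /P; case: ifPn => // _; rewrite mulr_ge0 ?powR_ge0.
have mW k : measurable_fun setT (W k).
  by apply: measurable_fun_ifT => //; exact: measurable_fun_ler.
have mpow (f : T -> R) q : measurable_fun setT f ->
    measurable_fun setT (fun x => f x `^ q * w x)%R.
  move=> mf; apply: measurable_funM => //.
  exact: (measurableT_comp (measurable_powR _)).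
have mP k : measurable_fun setT (P k).
  apply: measurable_fun_ifT => //; last exact: mpow.
  by apply: measurable_fun_ler => //; exact: measurable_funM.
have intZ (c : 'I_m -> R) (G : 'I_m -> T -> R) :
    (forall k, 0 <= c k)%R -> (forall k x, 0 <= G k x)%R ->
    (forall k, measurable_fun setT (G k)) ->
    \int[mu]_x (\sum_(k < m) c k * G k x)%:E =
    \sum_(k < m) (c k)%:E * \int[mu]_x (G k x)%:E.
  move=> c0 G0 mG; under eq_integral do rewrite -sumEFin.
  rewrite ge0_integral_sum//.
  - apply: eq_bigr => k _; under eq_integral do rewrite EFinM.
    rewrite ge0_integralZl_EFin//; last exact/measurable_EFinP.
    by move=> x _; rewrite lee_fin.
  - by move=> k; apply/measurable_EFinP; exact: measurable_funM.
  - by move=> k x _; rewrite lee_fin mulr_ge0.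
(* Layer-cake in the power p, exact enough because [h x] is itself a level. *)
have stepW : \int[mu]_x (h x `^ p * w x)%:E <=
    \sum_(k < m) (a k)%:E * \int[mu]_x (W k x)%:E.
  rewrite -(intZ (fun k => a k) (fun k => W k))//; last first.
    by move=> k; exact: a0.
  apply: ge0_le_integralT => x.
    by rewrite lee_fin mulr_ge0 ?powR_ge0.
  rewrite lee_fin /W; have [j jm ->] := hu x.
  apply: le_trans (ler_wpM2r (w0 x) (telescope_ge (pow0 _ p0) (powle _ p0) erefl ndu jm)) _.
  rewrite mulr_suml; apply: ler_sum => k _.
  by rewrite /a; case: ifPn; rewrite ?mulr0 ?mul0r.
apply: le_trans stepW _.
(* Layer-cake in the power p - r at the point [2 * psi x]; the factor psi^r in [P k] restores
   psi^p. *)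
have stepP : \sum_(k < m) (b k)%:E * \int[mu]_x (P k x)%:E <=
    (2 `^ (p - r))%:E * \int[mu]_x (psi x `^ p * w x)%:E.
  rewrite -(intZ (fun k => b k) (fun k => P k))//; last first.
    by move=> k; exact: b0.
  rewrite -ge0_integralZl_EFin ?powR_ge0//; last 2 first.
    by move=> x _; rewrite lee_fin mulr_ge0 ?powR_ge0.
    by apply/measurable_EFinP; exact: mpow.
  apply: ge0_le_integralT => x.
    by rewrite lee_fin; apply: sumr_ge0 => k _; rewrite mulr_ge0 ?b0.
  rewrite -EFinM lee_fin.
  have psi2 : (0 <= 2 * psi x)%R by rewrite mulr_ge0.
  have := telescope_le (pow0 _ pr0) (powle _ pr0) erefl ndu psi2.
  rewrite powRM// => /(ler_wpM2r (mulr_ge0 (powR_ge0 (psi x) r) (w0 x))).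
  rewrite mulr_suml -!mulrA [X in (_ <= _ * X)%R]mulrA -powRD ?subrK; last first.
    by rewrite gt_eqF.
  apply: le_trans; apply: ler_sum => k _; rewrite /P /b.
  by case: ifPn; rewrite ?mulr0 ?mul0r.
have Cge0 : (0 <= p / (p - r) * 2 `^ r)%R.
  by rewrite mulr_ge0 ?powR_ge0// divr_ge0// ltW.
apply: (@le_trans _ _ (K * (p / (p - r) * 2 `^ r)%:E *
    \sum_(k < m) (b k)%:E * \int[mu]_x (P k x)%:E)); last first.
  rewrite -!muleA; apply: lee_wpmul2l => //.
  apply: le_trans (lee_wpmul2l _ stepP) _; first by rewrite lee_fin.
  rewrite muleA -EFinM -(mulrA (p / (p - r))%R) -powRD ?(addrC r) ?subrK; last by rewrite gt_eqF.
  by rewrite mulrC.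
rewrite ge0_sume_distrr; last first.
  move=> k _; apply: mule_ge0; rewrite ?lee_fin ?b0//.
  by apply: integral_ge0 => x _; rewrite lee_fin.
apply: lee_sum => k _.
have IW0 : 0 <= \int[mu]_x (W k x)%:E.
  by apply: integral_ge0 => x _; rewrite lee_fin.
apply: (@le_trans _ _ ((p / (p - r) * (u k.+1 `^ r * b k))%:E * \int[mu]_x (W k x)%:E)).
  apply: lee_wpmul2r => //; rewrite lee_fin powR_diff_le ?u_ge0//.
  exact: ltnW.
(* Writing u^r = 2^r (u / 2)^r fits the weak-type hypothesis at t = [u k.+1]; this 2^r and the 2^(p
   - r) of [stepP] make up 2^p. *)
have -> : (p / (p - r) * (u k.+1 `^ r * b k) =
    (p / (p - r) * 2 `^ r * b k) * (u k.+1 / 2) `^ r)%R.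
  have -> : (u k.+1 `^ r = 2 `^ r * (u k.+1 / 2) `^ r)%R.
    by rewrite -powRM ?divr_ge0 ?u_ge0// mulrC divfK.
  by ring.
rewrite EFinM -muleA [X in _ * X <= _]muleC.
apply: le_trans (lee_wpmul2l _ (weak _ (u_gt0 _ (ltn_ord k)))) _.
  by rewrite lee_fin mulr_ge0 ?b0.
by rewrite (EFinM _ (b k)) muleCA muleA -!muleA.
Qed.

End interpolation_integral.

(** * Maximal functions *)

Section finite_maximal.
Context {R : realType} {d : nat}.
Variables (a : nat -> Rn R d) (l c : nat -> R).
Local Notation lambda := (@lebesgue R d).

(** The numbers [c i] stand for lower bounds of the averages of [psi], as in [c_le], so that they
    can be taken rational. Only 0 and finitely many [c i] occur as values, which suits the
    interpolation. *)
Fixpoint finite_maximal n (x : Rn R d) : R :=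
  if n is m.+1 then
    Order.max (finite_maximal m x) (c m * \1_(box (a m) (l m)) x)%R
  else 0%R.

Lemma measurable_finite_maximal n : measurable_fun setT (finite_maximal n).
Proof.
elim: n => [|n IH]; first exact: measurable_cst.
exact: (measurable_fun_max_indic _ IH (measurable_box _ _)).
Qed.

Lemma finite_maximal_ge0 n x : (0 <= finite_maximal n x)%R.
Proof. by elim: n => //= n IH; rewrite le_max IH. Qed.

Lemma finite_maximal_homo x :
  {homo finite_maximal^~ x : m n / (m <= n)%N >-> (m <= n)%R}.
Proof.
apply: homo_leq => //; first by move=> ? ? ?; exact: le_trans.
by move=> n; rewrite le_max lexx.
Qed.

Lemma le_finite_maximal n i x : (i < n)%N -> box (a i) (l i) x ->
  (c i <= finite_maximal n x)%R.
Proof.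
move=> ni xi; apply: le_trans (finite_maximal_homo x ni).
by rewrite /= le_max indicE mem_set// mulr1 lexx orbT.
Qed.

Lemma finite_maximal_geP n x t : (0 < t)%R -> (t <= finite_maximal n x)%R ->
  exists i, [/\ (i < n)%N, (t <= c i)%R & box (a i) (l i) x].
Proof.
move=> t0; elim: n => [|n IH] /=; first by rewrite leNgt t0.
rewrite le_max => /orP[/IH[i [ni ti xi]]|]; first by exists i; rewrite ltnW.
rewrite indicE; case: (boolP (x \in _)) => [/set_mem xn|_].
  by rewrite mulr1 => tn; exists n.
by rewrite mulr0 leNgt t0.
Qed.

Lemma finite_maximal_mem n x :
  finite_maximal n x \in 0%R :: [seq c i | i <- iota 0 n].
Proof.
elim: n => [|n IH]; first exact: mem_head.
rewrite -addn1 iotaD map_cat -cat_cons mem_cat addn1 /= /Order.max.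
case: ifP => _; last by rewrite IH.
rewrite indicE; case: (x \in _); last by rewrite mulr0 mem_head.
by rewrite mulr1 mem_head orbT.
Qed.

Hypothesis l0 : forall i, (0 < l i)%R.

Variables (w psi : Rn R d -> R) (r : R).
Hypotheses (mw : measurable_fun setT w) (w0 : forall x, (0 < w x)%R).
Hypotheses (mpsi : measurable_fun setT psi) (psi0 : forall x, (0 <= psi x)%R).
Hypothesis r1 : (1 < r)%R.
Hypothesis c_le : forall i,
  (c i * l i ^+ d)%:E <= \int[lambda]_(x in box (a i) (l i)) (psi x)%:E.

Let r0 : (0 < r)%R. Proof. exact: lt_trans r1. Qed.

(* Only the part of [psi] above [t / 2] matters on the cubes of average at
   least [t]. *)
Lemma finite_maximal_weak_type n (t : R) : (0 < t)%R ->
  \int[lambda]_x (if (t <= finite_maximal n x)%R then w x else 0%R)%:E *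
    ((t / 2) `^ r)%:E <=
  A_const r w * ((3 ^+ d) `^ r)%:E *
    \int[lambda]_x (if (t <= 2 * psi x)%R then psi x `^ r * w x else 0)%R%:E.
Proof.
move=> t0.
have t20 : (0 < t / 2)%R by rewrite divr_gt0.
have A0 : 0 <= A_const r w * ((3 ^+ d) `^ r)%:E.
  by rewrite mule_ge0 ?lee_fin ?powR_ge0// (le_trans _ (A_const_ge1 r1 mw w0)).
pose psi1 x := if (t <= 2 * psi x)%R then psi x else 0%R.
have psi10 x : (0 <= psi1 x)%R by rewrite /psi1; case: ifP.
have mpsi1 : measurable_fun setT psi1.
  exact: (measurable_fun_truncation t (measurable_funMl 2 mpsi) mpsi).
pose F x := (psi1 x `^ r * w x)%R.
have F0 x : (0 <= F x)%R by rewrite mulr_ge0 ?powR_ge0// ltW.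
have mF : measurable_fun setT F.
  exact: (measurable_fun_powRM r mpsi1 mw).
have -> : \int[lambda]_x (if (t <= 2 * psi x)%R then psi x `^ r * w x else 0)%R%:E
    = \int[lambda]_x (F x)%:E.
  apply: eq_integral => x _; rewrite /F /psi1; case: ifP => //.
  by rewrite powR0 ?mul0r// gt_eqF.
pose B i := box (a i) (l i); pose B3 i := triple_box (a i) (l i).
have mB i : measurable (B i) by exact: measurable_box.
have mB3 i : measurable (B3 i) by exact: measurable_box.
(* Vitali is applied to those of the first [n] cubes with [t <= c i], which cover the superlevel
   set. *)
have [D [uD Ds trD covD]] := vitali_boxes a [seq i <- iota 0 n | (t <= c i)%R]
  (fun i => ltW (l0 i)).
have tc i : i \in D -> (t <= c i)%R.
  by move=> /Ds; rewrite mem_filter => /andP[].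
have avg1 i : i \in D ->
    (t / 2 * l i ^+ d)%:E <= \int[lambda]_(x in B i) (psi1 x)%:E.
  move=> iD; apply: (integral_truncation (mB i)) => //.
  - exact: (lebesgue_box _ (ltW (l0 i))).
  - exact: ltW.
  - by apply: le_trans (c_le i); rewrite lee_fin ler_pM2r ?exprn_gt0// tc.
(* The triples of the selected cubes cover the superlevel set; each triple is then tested against
   its cube, and the disjoint cubes are summed. *)
apply: (@le_trans _ _ ((\sum_(j <- D) \int[lambda]_(x in B3 j) (w x)%:E) *
    ((t / 2) `^ r)%:E)).
  apply: lee_wpmul2r; first by rewrite lee_fin powR_ge0.
  apply: (integral_cover lambda mw _ mB3) => [x|x /(finite_maximal_geP t0)].
    exact: ltW.
  move=> [i [ni ti xi]].
  have [|j jD ij] := covD i; first by rewrite mem_filter ti mem_iota.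
  by exists j => //; exact: ij.
rewrite ge0_sume_distrl; last first.
  by move=> j _; apply: integral_ge0 => x _; rewrite lee_fin ltW.
apply: (@le_trans _ _ (\sum_(j <- D) A_const r w * ((3 ^+ d) `^ r)%:E *
    \int[lambda]_(x in B j) (F x)%:E)).
  rewrite big_seq [leRHS]big_seq; apply: lee_sum => j jD.
  exact: (A_const_test (l0 j) r1 mw w0 mpsi1 psi10 (ltW t20) (avg1 _ jD)).
rewrite -ge0_sume_distrr; last first.
  by move=> j _; apply: integral_ge0 => x _; rewrite lee_fin.
apply: lee_wpmul2l => //.
exact: (sum_integral_disjoint lambda mF F0 mB uD trD).
Qed.

Lemma finite_maximal_strong_type n (p : R) : (r < p)%R ->
  \int[lambda]_x (finite_maximal n x `^ p * w x)%:E <=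
  A_const r w * ((3 ^+ d) `^ r)%:E * (2 `^ p * (p / (p - r)))%:E *
    \int[lambda]_x (psi x `^ p * w x)%:E.
Proof.
move=> rp; apply: weak_type_interpolation (finite_maximal_mem n) _ _ _ _ => //.
- exact: measurable_finite_maximal.
- by move=> x; exact: ltW.
- exact: finite_maximal_ge0.
- by rewrite mule_ge0 ?lee_fin ?powR_ge0// (le_trans _ (A_const_ge1 r1 mw w0)).
- exact: finite_maximal_weak_type.
Qed.

End finite_maximal.

(** * Reduction to rational cubes *)

Section rational_boxes.
Context {R : realType} {d : nat}.
Local Notation lambda := (@lebesgue R d).

Lemma rat_between (x y : R) : (x < y)%R ->
  exists q : rat, (x < ratr q)%R /\ (ratr q < y)%R.
Proof. by move=> /rat_in_itvoo[q]; rewrite in_itv => /andP[]; exists q. Qed.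

(** A rational side in (3l/2, 2l) and corner coordinates less than [l / 2] below those of [a] leave
    room for the side [l]. *)
Lemma box_sub_rational (a : Rn R d) (l : R) : (0 < l)%R ->
  exists (b : d.-tuple rat) (m : rat), [/\ 0 < m, ratr m <= 2 * l &
    box a l `<=` box (Rn_of (fun i => ratr (tnth b i))) (ratr m)]%R.
Proof.
move=> l0.
have /rat_between[m [m1 m2]] : (l + l / 2 < 2 * l)%R by lra.
have bP i : exists q : rat, (Rn_coord a i - l / 2 < ratr q)%R /\
    (ratr q < Rn_coord a i)%R.
  by apply: rat_between; lra.
exists [tuple sval (cid (bP i)) | i < d], m; split.
- by rewrite -(ltr_rat R) rmorph0; lra.
- exact: ltW.
- move=> x xa i; rewrite Rn_coord_of tnth_mktuple.
  by case: cid => q /= []; move: (xa i); lra.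
Qed.

(** All triples of a rational corner, a rational side and a rational lower bound of the average are
    enumerated. An average above [y] on a cube survives, up to the factor 2^d, on a rational cube
    that contains it and has at most twice its side. *)
Lemma exists_box_family (psi : Rn R d -> R) :
  measurable_fun setT psi -> (forall x, 0 <= psi x)%R ->
  exists (a : nat -> Rn R d) (l c : nat -> R), [/\ forall i, (0 < l i)%R,
    forall i, (c i * l i ^+ d)%:E <=
              \int[lambda]_(x in box (a i) (l i)) (psi x)%:E &
    forall (b : Rn R d) (m y : R) x, (0 < m)%R -> (0 <= y)%R -> box b m x ->
      (y * m ^+ d)%:E < \int[lambda]_(u in box b m) (psi u)%:E ->
      exists2 i, box (a i) (l i) x & (y < 2 ^+ d * c i)%R].
Proof.
move=> mpsi psi0.
have int_ge0 (B : set (Rn R d)) : 0 <= \int[lambda]_(x in B) (psi x)%:E.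
  by apply: integral_ge0 => x _; rewrite lee_fin.
pose A (b : d.-tuple rat) : Rn R d := Rn_of (fun i => ratr (tnth b i)).
pose ok (z : d.-tuple rat * rat * rat) := (0 < z.1.2)%R /\
  (ratr z.2 * ratr z.1.2 ^+ d)%:E <=
    \int[lambda]_(x in box (A z.1.1) (ratr z.1.2)) (psi x)%:E.
(* Codes of no admissible triple are sent to the unit cube with the bound 0. *)
pose z0 : d.-tuple rat * rat * rat := ([tuple 0%R | i < d], 1%R, 0%R).
have okz0 : ok z0 by split => //=; rewrite rmorph0 mul0r.
pose z (n : nat) := if unpickle n is Some y then
  (if `[< ok y >] then y else z0) else z0.
have okz n : ok (z n).
  by rewrite /z; case: unpickle => // y; case: asboolP.
exists (fun n => A (z n).1.1), (fun n => ratr (z n).1.2),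
  (fun n => ratr (z n).2); split.
- by move=> i; have [? _] := okz i; rewrite ltr0q.
- by move=> i; have [_] := okz i.
move=> b m y x m0 y0 xb ym.
have [b' [m' [m'0 m'2 sub]]] := box_sub_rational b m0.
have rm0 : (0 < ratr m' :> R)%R by rewrite ltr0q.
have I_le : \int[lambda]_(u in box b m) (psi u)%:E <=
    \int[lambda]_(u in box (A b') (ratr m')) (psi u)%:E.
  apply: (ge0_subset_integral lambda (measurable_box _ _) (measurable_box _ _)).
  - by apply/measurable_EFinP; exact: (measurable_funTS mpsi).
  - by move=> u _; rewrite lee_fin.
  - exact: sub.
have [v [yv vI]] : exists v : R, (y * m ^+ d < v)%R /\
    v%:E <= \int[lambda]_(u in box (A b') (ratr m')) (psi u)%:E.
  have := lt_le_trans ym I_le; case: (integral _ _ _) => [v||] //.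
    by rewrite lte_fin => yv; exists v.
  by move=> _; exists (y * m ^+ d + 1)%R; rewrite ltrDl leey.
have rmd : (0 < ratr m' ^+ d :> R)%R by rewrite exprn_gt0.
have /rat_between[c [c1 c2]] :
    (y * m ^+ d / ratr m' ^+ d < v / ratr m' ^+ d)%R.
  by rewrite ltr_pM2r ?invr_gt0.
have okc : ok (b', m', c).
  split => //=; apply: le_trans vI.
  by rewrite lee_fin -ler_pdivlMr// ltW.
exists (pickle (b', m', c)); rewrite /z pickleK asboolT//=.
  exact: sub.
have md : (0 < m ^+ d)%R by rewrite exprn_gt0.
have c0 : (0 < ratr c :> R)%R.
  by apply: le_lt_trans c1; rewrite divr_ge0 ?(ltW rmd)// mulr_ge0// ltW.
move: c1; rewrite ltr_pdivrMr// => c1.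
rewrite -(ltr_pM2r md); apply: lt_le_trans c1 _.
have -> : (2 ^+ d * ratr c * m ^+ d = ratr c * (2 * m) ^+ d)%R.
  by rewrite exprMn; ring.
rewrite ler_pM2l//.
by rewrite lerXn2r// nnegrE ltW// mulr_gt0.
Qed.

End rational_boxes.

Section maximal_bound.
Context {R : realType} {d : nat}.
Local Notation lambda := (@lebesgue R d).

(* [S] is the [p]-th power of the maximal function of [psi] over countably many
   rational cubes, which makes it measurable; replacing a cube by a rational one
   costs the factor [2 ^ d]. *)
Lemma maximal_majorant (w psi : Rn R d -> R) (p : R) :
  measurable_fun setT w -> (forall x, 0 < w x)%R ->
  measurable_fun setT psi -> (forall x, 0 <= psi x)%R -> (1 < p)%R ->
  exists S : Rn R d -> \bar R, [/\ measurable_fun setT S, forall x, 0 <= S x,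
    forall a l x, (0 < l)%R -> box a l x ->
      \int[lambda]_(u in box a l) (psi u)%:E <=
        ((2 * l) ^+ d)%:E * S x `^ p^-1 &
    forall r, (1 < r)%R -> (r < p)%R ->
      \int[lambda]_x (S x * (w x)%:E) <=
      A_const r w * ((3 ^+ d) `^ r)%:E * (2 `^ p * (p / (p - r)))%:E *
        \int[lambda]_x (psi x `^ p * w x)%:E].
Proof.
move=> mw w0 mpsi psi0 p1.
have p0 : (0 < p)%R by exact: lt_trans p1.
have [a [l [c [l0 c_le fam]]]] := exists_box_family mpsi psi0.
pose f n x := finite_maximal a l c n x.
pose S x := ereal_sup (range (fun n => (f n x `^ p)%:E)).
have f0 n x : (0 <= f n x)%R by exact: finite_maximal_ge0.
have S0 x : 0 <= S x.
  apply: (@le_trans _ _ (f 0%N x `^ p)%:E); first by rewrite lee_fin powR_ge0.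
  by apply: ereal_sup_ubound; exists 0%N.
have ndf x : {homo f^~ x : m n / (m <= n)%N >-> (m <= n)%R}.
  exact: finite_maximal_homo.
have ndfp x : {homo (fun n => f n x `^ p)%R : m n / (m <= n)%N >-> (m <= n)%R}.
  move=> m n mn; apply: ge0_ler_powR; first exact: ltW.
  - by rewrite nnegrE.
  - by rewrite nnegrE.
  - exact: ndf.
have mS : measurable_fun setT S.
  apply: (emeasurable_fun_cvg (fun n x => (f n x `^ p)%:E)).
    move=> n; apply/measurable_EFinP.
    apply: (measurableT_comp (measurable_powR p)).
    exact: measurable_finite_maximal.
  move=> x _; apply: ereal_nondecreasing_cvgn => m n mn.
  by rewrite lee_fin ndfp.
exists S; split => //.
(* Otherwise the average exceeds 2^d S^(1/p), so the family has a cube through [x] with [c i] above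
   S^(1/p), against the definition of S. *)
- move=> b m x m0 xb; rewrite leNgt; apply/negP => h.
  have m2 : (0 < (2 * m) ^+ d)%R by rewrite exprn_gt0// mulr_gt0.
  case E : (S x) h => [s||]; last 2 first.
  + rewrite poweRyr ?invr_neq0 ?gt_eqF// gt0_muley ?lte_fin//.
    by rewrite ltNge leey.
  + by move: (S0 x); rewrite E.
  rewrite poweR_EFin -EFinM => h.
  have s0 : (0 <= s `^ p^-1)%R by exact: powR_ge0.
  have s0' : (0 <= s)%R by rewrite -lee_fin -E.
  have := fam b m (2 ^+ d * s `^ p^-1)%R x m0 _ xb.
  rewrite mulr_ge0 ?exprn_ge0// => /(_ isT) [|i xi].
    by rewrite mulrAC -exprMn.
  rewrite ltr_pM2l ?exprn_gt0// => sc.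
  have : (f i.+1 x `^ p)%:E <= S x by apply: ereal_sup_ubound; exists i.+1.
  rewrite E lee_fin => fs.
  have := le_finite_maximal c (ltnSn i) xi; rewrite leNgt => /negP; apply.
  apply: le_lt_trans sc.
  have fE : f i.+1 x = ((f i.+1 x `^ p) `^ p^-1)%R.
    by rewrite -powRrM divff ?gt_eqF// powRr1.
  rewrite -[leLHS]/(f i.+1 x) fE.
  by apply: ge0_ler_powR; rewrite ?nnegrE ?powR_ge0// invr_ge0 ltW.
- move=> r r1 rp.
  have -> : \int[lambda]_x (S x * (w x)%:E) =
      \int[lambda]_x ereal_sup (range (fun n => (f n x `^ p * w x)%:E)).
    apply: eq_integral => x _; rewrite muleC -ereal_sup_pZl//; congr ereal_sup.
    apply/seteqP; split => [_ [_ [n _ <-] <-]|_ [n _ <-]].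
      by exists n => //; rewrite mulrC EFinM.
    by exists (f n x `^ p)%:E; [exists n|rewrite mulrC EFinM].
  apply: integral_sup_le.
  + move=> n.
    exact: (measurable_fun_powRM p (measurable_finite_maximal a l c n) mw).
  + by move=> n x; rewrite mulr_ge0 ?powR_ge0// ltW.
  + move=> x m n mn; rewrite ler_pM2r//; exact: ndfp.
  + by move=> n; exact: finite_maximal_strong_type.
Qed.

End maximal_bound.

(** * Fractional maximal function *)

Section fractional.
Local Open Scope ring_scope.
Context {R : realType}.

(** The hypothesis on P is P = q/p' + 1 cleared of division. With D the denominator in s, D - r q =
    p (P - r) gives q/s = D / (p (P - r)), and the last bound reduces to D - P p = r (q - p) >=
    0. *)
Lemma exponents (p q r P : R) : 1 < p -> p <= q -> P * p = q * (p - 1) + p ->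
  1 < r -> r < P ->
  let s := s_exponent p q r in
  [/\ 0 < q - s, q - s <= q & P / (P - r) <= q / s].
Proof.
move=> p1 pq PE r1 rP s.
have p0 : 0 < p by lra.
have q0 : 0 < q by lra.
have P0 : 0 < P by lra.
set D := (r - 1) * (q - p) + p * q.
have D0 : 0 < D.
  by rewrite ltr_wpDl ?mulr_gt0// mulr_ge0//; lra.
have DE : D - r * q = p * (P - r) by rewrite /D; lra.
have tE : q - s = r * q ^+ 2 / D by rewrite /s /s_exponent -/D; ring.
have sE : s = q * (p * (P - r)) / D.
  by rewrite /s /s_exponent -/D -DE; field; rewrite gt_eqF.
have s0 : 0 < s.
  by rewrite sE divr_gt0// mulr_gt0// mulr_gt0// subr_gt0.
split.
- by rewrite tE divr_gt0// mulr_gt0 ?exprn_gt0//; lra.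
- by lra.
- have -> : q / s = D / (p * (P - r)).
    by rewrite sE; field; rewrite !gt_eqF// subr_gt0.
  rewrite ler_pdivlMr ?mulr_gt0 ?subr_gt0// mulrA.
  rewrite (_ : P / (P - r) * p * (P - r) = P * p); last first.
    by field; rewrite gt_eqF// subr_gt0.
  rewrite PE -subr_ge0 (_ : _ - _ = r * (q - p)); last by rewrite /D; ring.
  by rewrite mulr_ge0//; lra.
Qed.

End fractional.

(** * Reduction to the Hardy-Littlewood operator *)

Section fractional_hoelder.
Context d (T : measurableType d) (R : realType).
Variable mu : {measure set T -> \bar R}.
Variables (p q theta : R) (phi w : T -> R).
Hypotheses (p0 : (0 < p)%R) (q0 : (0 < q)%R) (theta01 : (0 <= theta < 1)%R).
Hypothesis pq : (q^-1 = p^-1 - theta)%R.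
Hypotheses (mphi : measurable_fun setT phi) (mw : measurable_fun setT w).
Hypothesis w0 : forall x, (0 < w x)%R.

(* With [P := q * (1 - theta)], the function to which the unfractional maximal
   operator is applied in [L^P(w)]. *)
Definition diagonalize (x : T) : R :=
  ((`|phi x| `^ p * w x `^ (p / q - 1)) `^ (q * (1 - theta))^-1)%R.

Lemma measurable_diagonalize : measurable_fun setT diagonalize.
Proof.
apply: (measurableT_comp (measurable_powR _)).
apply: measurable_fun_powRM; first exact: measurableT_comp.
exact: (measurableT_comp (measurable_powR _)).
Qed.

Lemma diagonalize_ge0 x : (0 <= diagonalize x)%R.
Proof. exact: powR_ge0. Qed.

Lemma diagonalizeE x :
  (diagonalize x `^ (q * (1 - theta)) * w x = `|phi x| `^ p * w x `^ (p / q))%R.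
Proof.
have t1 : (0 < 1 - theta)%R by move: theta01 => /andP[_]; rewrite subr_gt0.
rewrite /diagonalize -powRrM mulVf ?mulf_neq0 ?gt_eqF//.
rewrite powRr1 ?mulr_ge0 ?powR_ge0// -mulrA; congr (_ * _)%R.
rewrite -[X in (_ * X)%R]powRr1 ?(ltW (w0 x))// -powRD ?subrK//.
by rewrite (gt_eqF (w0 x)) implybT.
Qed.

(** Hoelder with t = theta for |phi| = (|phi|^p w^(p/q))^theta psi^(1 - theta): as theta = 1/p -
    1/q, the exponents of |phi| add up to 1 and those of w to 0. *)
Lemma fractional_hoelder (B : set T) : measurable B ->
  \int[mu]_(x in B) `|phi x|%:E <=
  (\int[mu]_(x in B) (`|phi x| `^ p * w x `^ (p / q))%:E) `^ theta *
  (\int[mu]_(x in B) (diagonalize x)%:E) `^ (1 - theta).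
Proof.
move=> mB; move: theta01 => /andP[t0 t1].
have t1' : (0 < 1 - theta)%R by rewrite subr_gt0.
have mF : measurable_fun setT (fun x => `|phi x| `^ p * w x `^ (p / q))%R.
  apply: measurable_fun_powRM; first exact: measurableT_comp.
  exact: (measurableT_comp (measurable_powR _)).
apply: le_trans (ge0_integral_hoelder mu mB mF measurable_diagonalize _
  diagonalize_ge0 _); last 2 first.
- by move=> x; rewrite mulr_ge0 ?powR_ge0.
- by rewrite t0 ltW.
rewrite le_eqVlt; apply/orP; left; apply/eqP; apply: eq_integral => x _.
congr EFin; rewrite /diagonalize -powRrM.
have -> : ((q * (1 - theta))^-1 * (1 - theta) = q^-1)%R.
  by field; rewrite !gt_eqF.
(* Adding exponents takes a nonzero base. Where phi vanishes, the second factor is 0 even if theta =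
   0 makes the first one 0^0 = 1. *)
have [phi0|phi0] := eqVneq `|phi x|%R 0%R.
  by rewrite phi0 powR0 ?gt_eqF// !mul0r [X in (_ * X)%R]powR0 ?mulr0// invr_neq0 ?gt_eqF.
have {}phi0 : (0 < `|phi x|)%R by rewrite lt_neqAle eq_sym phi0 normr_ge0.
rewrite !powRM ?powR_ge0// -!powRrM mulrACA -!powRD; last 2 first.
- by rewrite (gt_eqF (w0 x)) implybT.
- by rewrite (gt_eqF phi0) implybT.
have tE : theta = (p^-1 - q^-1)%R by rewrite pq; ring.
rewrite (_ : p * theta + p * q^-1 = 1)%R; last first.
  by rewrite tE; field; rewrite !gt_eqF.
rewrite (_ : p / q * theta + (p / q - 1) * q^-1 = 0)%R; last first.
  by rewrite tE; field; rewrite !gt_eqF.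
by rewrite powRr0 mulr1 powRr1.
Qed.

End fractional_hoelder.

(** * The inequality for a fixed r *)

Section maximal_inequality.
Context {R : realType} {d : nat}.
Local Notation lambda := (@lebesgue R d).

Lemma wnorm_ge0 (p : R) (w : Rn R d -> R) (f : Rn R d -> \bar R) :
  0 <= wnorm p w f.
Proof. exact: poweR_ge0. Qed.

Lemma frac_maximal_ge0 (alpha : R) (phi : Rn R d -> R) x :
  0 <= frac_maximal alpha phi x.
Proof.
apply: le_trans (ereal_sup_ubound _); last first.
  exists (box x 1) => //=; split; first by exists x, 1%R.
  by move=> i; rewrite lexx lerDl ler01.
by rewrite mule_ge0 ?poweR_ge0// integral_ge0// => u _; rewrite lee_fin.
Qed.

Variables (alpha p q : R) (w phi : Rn R d -> R).
Hypotheses (d1 : (1 <= d)%N) (alpha0 : (0 <= alpha)%R) (alphad : (alpha < d%:R)%R).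
Hypotheses (p1 : (1 < p)%R) (p_le_q : (p <= q)%R).
Hypothesis pq : (q^-1 = p^-1 - alpha / d%:R)%R.
Hypotheses (mw : measurable_fun setT w) (w0 : forall x, (0 < w x)%R).
Hypothesis mphi : measurable_fun setT phi.

Let theta : R := (alpha / d%:R)%R.
Let P : R := (q * (1 - theta))%R.
Let psi := diagonalize p q theta phi w.
Let N : \bar R := \int[lambda]_x (`|phi x| `^ p * w x `^ (p / q))%:E.

Let p0 : (0 < p)%R. Proof. exact: lt_trans p1. Qed.
Let q0 : (0 < q)%R. Proof. exact: lt_le_trans p_le_q. Qed.
Let theta01 : (0 <= theta < 1)%R.
Proof.
have d0 : (0 < d%:R :> R)%R by rewrite ltr0n.
by rewrite divr_ge0//= ltr_pdivrMr// mul1r.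
Qed.
Let theta1 : (0 < 1 - theta)%R.
Proof. by move: theta01 => /andP[_]; rewrite subr_gt0. Qed.
Let PE : (P * p = q * (p - 1) + p)%R.
Proof.
have -> : P = (q * (1 - (p^-1 - q^-1)))%R by rewrite pq /P /theta; ring.
by field; rewrite !gt_eqF.
Qed.
Let P_gt1 : (1 < P)%R.
Proof.
rewrite -(ltr_pM2r p0) PE mul1r ltrDr mulr_gt0// subr_gt0//.
Qed.
Let N0 : 0 <= N.
Proof. by apply: integral_ge0 => x _; rewrite lee_fin mulr_ge0 ?powR_ge0. Qed.

(** The factor |Q|^(theta - 1) cancels the |Q|^(1 - theta) from the bound on the integral of psi,
    and P = q (1 - theta) turns S^((1 - theta)/P) into S^(1/q). *)
Lemma frac_maximal_le (S : Rn R d -> \bar R) x : 0 <= S x ->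
  (forall a l, (0 < l)%R -> box a l x ->
    \int[lambda]_(u in box a l) (psi u)%:E <=
      ((2 * l) ^+ d)%:E * S x `^ P^-1) ->
  frac_maximal alpha phi x <=
    N `^ theta * ((2 ^+ d) `^ (1 - theta))%:E * S x `^ q^-1.
Proof.
move=> S0 HS; apply: ub_ereal_sup => _ [Q [[a [l [l0 ->]]] xQ] <-].
have ld0 : (0 < l ^+ d)%R by rewrite exprn_gt0.
rewrite -[X in (lambda X) `^ _]/(box a l) lebesgue_box ?(ltW l0)// poweR_EFin.
have mB := measurable_box a l.
have := fractional_hoelder lambda p0 q0 theta01 pq mphi mw w0 mB.
have NB : \int[lambda]_(u in box a l) (`|phi u| `^ p * w u `^ (p / q))%:E <= N.
  rewrite [leLHS]integral_mkcond; apply: ge0_le_integralT => u.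
    by apply: erestrict_ge0 => v _; rewrite lee_fin mulr_ge0 ?powR_ge0.
  by rewrite patchE; case: ifPn => // _; rewrite lee_fin mulr_ge0 ?powR_ge0.
have powle (r : R) (u v : \bar R) : (0 <= r)%R -> 0 <= u -> u <= v ->
    u `^ r <= v `^ r.
  move=> r0 u0 uv; apply: gt0_ler_poweR => //; rewrite in_itv/= leey andbT//.
  exact: le_trans uv.
have int0 (f : Rn R d -> R) : (forall u, 0 <= f u)%R ->
    0 <= \int[lambda]_(u in box a l) (f u)%:E.
  by move=> f0; apply: integral_ge0 => u _; rewrite lee_fin.
move=> H; apply: (@le_trans _ _ (((l ^+ d) `^ (theta - 1))%:E *
   (N `^ theta * (((2 * l) ^+ d)%:E * S x `^ P^-1) `^ (1 - theta)))).
  apply: lee_wpmul2l; first by rewrite lee_fin powR_ge0.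
  apply: le_trans H _; apply: lee_pmul; rewrite ?poweR_ge0//.
    apply: powle NB; first by case/andP: theta01.
    by apply: int0 => u; rewrite mulr_ge0 ?powR_ge0.
  apply: powle (HS _ _ l0 xQ); first exact: ltW.
  by apply: int0 => u; exact: diagonalize_ge0.
rewrite poweRM ?poweR_ge0 ?lee_fin ?exprn_ge0 ?mulr_ge0 ?(ltW l0)//.
rewrite -poweRrM poweR_EFin exprMn powRM ?exprn_ge0 ?(ltW l0)//.
have -> : (P^-1 * (1 - theta) = q^-1)%R by rewrite /P; field; rewrite !gt_eqF.
rewrite muleCA -[leRHS]muleA; apply: lee_wpmul2l; first exact: poweR_ge0.
rewrite muleA -EFinM mulrCA -powRD; last by rewrite (gt_eqF ld0) implybT.
by rewrite (_ : theta - 1 + (1 - theta) = 0)%R ?powRr0 ?mulr1//; ring.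
Qed.

(** As P/q = 1 - theta <= 1 and r/q <= 1, each base, being at least 1, bounds its power; the
    remaining 2 is at most 2^d because d >= 1. *)
Lemma maximal_constant (r : R) : (0 < r)%R -> (r < P)%R ->
  ((2 ^+ d) `^ (1 - theta) * ((3 ^+ d) `^ r * 2 `^ P) `^ q^-1 <= 12%:R ^+ d)%R.
Proof.
move=> r0 rP.
have Pq : (P * q^-1 = 1 - theta)%R by rewrite /P; field; rewrite gt_eqF.
have t1 : (1 - theta <= 1)%R by rewrite gerBl; case/andP: theta01.
have rq : (r * q^-1 <= 1)%R.
  by apply: le_trans t1; rewrite -Pq ler_pM2r ?invr_gt0// ltW.
rewrite powRM ?powR_ge0// -!powRrM Pq.
have -> : (12%:R ^+ d = 2 ^+ d * (3 ^+ d * 2 ^+ d) :> R)%R.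
  by rewrite -!exprMn; congr (_ ^+ _)%R; ring.
have ge1 (a : R) : (1 <= a)%R -> (1 <= a ^+ d)%R.
  by move=> a1; rewrite exprn_ege1.
have a2 : (1 <= 2 :> R)%R by rewrite ler1n.
have a3 : (1 <= 3 :> R)%R by rewrite ler1n.
apply: ler_pM; rewrite ?mulr_ge0 ?powR_ge0//.
  by apply: ler1_powR => //; exact: ge1.
apply: ler_pM; rewrite ?powR_ge0//.
  by apply: ler1_powR => //; exact: ge1.
apply: (@le_trans _ _ 2%R); first exact: ler1_powR.
by rewrite -[leLHS]expr1 ler_weXn2l.
Qed.

Lemma frac_maximal_norm_le (r : R) : (1 < r)%R -> (r < P)%R ->
  wnorm q w (frac_maximal alpha phi) <=
  (12%:R ^+ d)%:E *
  (A_const r w `^ (q - s_exponent p q r)^-1 *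
     ((q / s_exponent p q r) `^ (q - s_exponent p q r)^-1)%R%:E) *
  wnorm p (fun u => w u `^ (p / q))%R (EFin \o phi).
Proof.
move=> r1 rP.
have [t0 tq sP] := exponents p1 p_le_q PE r1 rP.
have r0 : (0 < r)%R by exact: lt_trans r1.
have -> : wnorm p (fun u => w u `^ (p / q))%R (EFin \o phi) = N `^ p^-1 by [].
have mpsi : measurable_fun setT psi by exact: measurable_diagonalize.
have [S [mS S0 HS HSr]] := maximal_majorant mw w0 mpsi
  (diagonalize_ge0 p q theta phi w) P_gt1.
have {HSr} := HSr r r1 rP.
have -> : \int[lambda]_x (psi x `^ P * w x)%:E = N.
  by apply: eq_integral => x _; rewrite diagonalizeE.
set A := A_const r w; set t := (q - s_exponent p q r)%R in t0 tq *.
set rho := (q / s_exponent p q r)%R in sP *.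
have A1 : 1 <= A by exact: A_const_ge1.
have A0 : 0 <= A by exact: le_trans A1.
pose k : R := ((2 ^+ d) `^ (1 - theta))%R.
pose K0 := N `^ (theta * q) * (k `^ q)%:E.
have K00 : 0 <= K0 by rewrite mule_ge0 ?poweR_ge0// lee_fin powR_ge0.
move=> HSr.
(* The pointwise bound is raised to the power q, where S^(1/q) becomes S, and integrated against
   w. *)
have step1 : \int[lambda]_x (`|frac_maximal alpha phi x| `^ q * (w x)%:E) <=
    K0 * (A * ((3 ^+ d) `^ r)%:E * (2 `^ P * (P / (P - r)))%:E * N).
  apply: le_trans (lee_wpmul2l K00 HSr).
  rewrite -(ge0_integralZl lambda measurableT); last 3 first.
  - have mwE : measurable_fun setT (EFin \o w) by apply/measurable_EFinP.
    exact: (emeasurable_funM mS mwE).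
  - by move=> x _; rewrite mule_ge0// lee_fin ltW.
  - exact: K00.
  apply: ge0_le_integralT => x.
    by rewrite mule_ge0 ?poweR_ge0// lee_fin ltW.
  rewrite muleA; apply: lee_wpmul2r; first by rewrite lee_fin ltW.
  rewrite gee0_abs ?frac_maximal_ge0//.
  have := frac_maximal_le (S0 x) (fun a l => HS a l x).
  move=> /(gt0_ler_poweR (ltW q0)).
  rewrite !in_itv/= !leey !andbT frac_maximal_ge0.
  rewrite !mule_ge0 ?poweR_ge0 ?lee_fin ?powR_ge0// => /(_ isT isT).
  rewrite poweRM ?mule_ge0 ?poweR_ge0 ?lee_fin ?powR_ge0//.
  rewrite poweRM ?poweR_ge0 ?lee_fin ?powR_ge0// poweR_EFin -!poweRrM.
  by rewrite mulVf ?gt_eqF// poweRe1.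
rewrite /wnorm.
have qV0 : (0 <= q^-1)%R by rewrite invr_ge0 ltW.
have PPr : (1 <= P / (P - r))%R.
  by rewrite ler_pdivlMr ?subr_gt0// mul1r gerBl ltW.
set G := \int[lambda]_x _ in step1 *.
have G0 : 0 <= G.
  apply: integral_ge0 => x _; rewrite mule_ge0 ?poweR_ge0// lee_fin.
  exact: ltW.
have rho1 : (1 <= rho)%R by exact: le_trans sP.
have := gt0_ler_poweR qV0 _ _ step1.
rewrite !in_itv/= !leey !andbT G0.
set c := ((3 ^+ d) `^ r)%R; set C2 := (2 `^ P)%R.
have c0 : (0 <= c)%R by exact: powR_ge0.
have C20 : (0 <= C2)%R by exact: powR_ge0.
have PPr0 : (0 <= P / (P - r))%R by exact: le_trans PPr.
have cc0 : (0 <= C2 * (P / (P - r)))%R by rewrite mulr_ge0.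
rewrite !mule_ge0// ?poweR_ge0// ?lee_fin ?powR_ge0// => /(_ isT isT).
move=> /le_trans; apply.
have k0 : (0 <= k)%R by exact: powR_ge0.
(* Since theta q + 1 = q/p, the q-th root of this product is N^(1/p), the norm of phi. *)
have NE : N `^ (theta * q) * N = N `^ (q / p).
  rewrite -[X in _ * X]poweRe1// -poweRD.
    congr (_ `^ _); have -> : theta = (p^-1 - q^-1)%R by rewrite pq /theta; ring.
    by field; rewrite !gt_eqF.
  by apply: add_neq0_poweRD_def; rewrite gt_eqF// ltr_wpDl// mulr_ge0// ?(ltW q0)//; case/andP: theta01.
have -> : K0 * (A * c%:E * (C2 * (P / (P - r)))%:E * N) =
    N `^ (q / p) * (A * (k `^ q * (c * C2) * (P / (P - r)))%:E).
  rewrite -NE /K0 -!muleA; congr (_ * _).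
  rewrite muleCA [RHS]muleCA; congr (_ * _).
  rewrite [in RHS]muleC !muleA -!EFinM; congr (_%:E * _); ring.
have kcC0 : (0 <= k `^ q * (c * C2))%R by rewrite !mulr_ge0 ?powR_ge0.
have kP0 : 0 <= (k `^ q * (c * C2) * (P / (P - r)))%:E.
  by rewrite lee_fin (mulr_ge0 kcC0 PPr0).
rewrite (poweRM _ (poweR_ge0 _ _) (mule_ge0 A0 kP0)) (poweRM _ A0 kP0).
rewrite poweR_EFin.
rewrite (powRM _ kcC0 PPr0) (powRM _ (powR_ge0 _ _) (mulr_ge0 c0 C20)).
rewrite -poweRrM -powRrM mulrAC !divff ?gt_eqF// mul1r powRr1//.
rewrite muleC EFinM muleCA -!muleA; apply: lee_pmul; rewrite ?lee_fin//.
- by rewrite mulr_ge0 ?powR_ge0.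
- by rewrite !mule_ge0 ?poweR_ge0// lee_fin powR_ge0.
- exact: maximal_constant.
rewrite muleA [leRHS]muleA; apply: lee_wpmul2r; first exact: poweR_ge0.
(* Both [A] and [rho] are at least 1, so the exponent 1/q may be raised to 1/t, where t = q - s <=
   q. *)
have tq' : (q^-1 <= t^-1)%R by rewrite lef_pV2 ?posrE.
apply: lee_pmul; rewrite ?poweR_ge0 ?lee_fin ?powR_ge0//.
  case: (A) A1 => [a|_|//]; last by rewrite !poweRyr ?invr_neq0 ?gt_eqF.
  by rewrite lee_fin => a1; rewrite !poweR_EFin lee_fin ler_powR.
apply: (@le_trans _ _ (rho `^ q^-1)%R); last exact: ler_powR.
by apply: ge0_ler_powR => //; rewrite nnegrE// (le_trans _ rho1).
Qed.

End maximal_inequality.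

Theorem theorem1p1 (R : realType) :
  exists C : R, C = 12%:R /\
  forall (d : nat) (alpha p q : R),
    (1 <= d)%N ->
    (0 <= alpha)%R -> (alpha < d%:R)%R ->
    (1 < p)%R -> (p <= q)%R ->
    (q^-1 = p^-1 - alpha / d%:R)%R ->
    let p' := (p / (p - 1))%R in
    forall w phi : Rn R d -> R,
      weight w -> A_const (q / p' + 1)%R w < +oo ->
      locally_integrable_Rn phi ->
      wnorm q w (frac_maximal alpha phi) <=
        (C ^+ d)%:E *
        ereal_inf
          [set A_const r w `^ (q - s_exponent p q r)^-1 *
               ((q / s_exponent p q r) `^ (q - s_exponent p q r)^-1)%R%:E
          | r in [set r : R | (1 < r < q / p' + 1)%R]] *
        wnorm p (fun u => w u `^ (p / q))%R (EFin \o phi).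
Proof.
exists 12%:R; split => // d alpha p q d1 alpha0 alphad p1 p_le_q pq p'.
move=> w phi [[mw _] w0] _ [mphi _].
have p0 : (0 < p)%R by exact: lt_trans p1.
have q0 : (0 < q)%R by exact: lt_le_trans p_le_q.
have PE : (q / p' + 1 = q * (1 - alpha / d%:R))%R.
  have -> : (alpha / d%:R = p^-1 - q^-1)%R by rewrite pq; ring.
  by rewrite /p'; field; rewrite !gt_eqF// subr_gt0.
have bound (r : R) := @frac_maximal_norm_le R d alpha p q w phi d1 alpha0
  alphad p1 p_le_q pq mw w0 mphi r.
rewrite PE; move: bound.
set P := (q * (1 - alpha / d%:R))%R.
set X := wnorm p _ _; set L := wnorm q w _; set V := [set _ | r in _] => bound.
have PpE : (P * p = q * (p - 1) + p)%R.
  by rewrite /P -PE /p'; field; rewrite !gt_eqF// subr_gt0.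
have C0 : (0 < 12%:R ^+ d :> R)%R by rewrite exprn_gt0.
(* The infimum is positive, so its product with an infinite norm of phi is infinite and not 0. *)
have V1 : 1 <= ereal_inf V.
  apply: le_ereal_inf_tmp => _ [r /andP[r1 rP] <-].
  have [t0 _ sP] := exponents p1 p_le_q PpE r1 rP.
  have A1 : 1 <= A_const r w by exact: A_const_ge1.
  rewrite -[1](mule1 1); apply: lee_pmul => //.
    rewrite -(poweR1r (q - s_exponent p q r)^-1).
    apply: gt0_ler_poweR => //; first by rewrite invr_ge0 ltW.
      by rewrite in_itv/= lee_fin ler01 leey.
    by rewrite in_itv/= leey andbT (le_trans _ A1).
  rewrite lee_fin -(powRr0 (q / s_exponent p q r)) ler_powR ?invr_ge0 ?(ltW t0)//.
  apply: le_trans sP; rewrite ler_pdivlMr ?subr_gt0// mul1r gerBl ltW//.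
  exact: lt_trans r1.
have LV v : V v -> L <= (12%:R ^+ d)%:E * v * X.
  by move=> [r /andP[r1 rP] <-]; exact: bound.
have : 0 <= X by exact: wnorm_ge0.
case: (X) LV => [x||//] LV; last first.
  move=> _; rewrite gt0_muley ?leey// mule_gt0 ?lte_fin//.
  exact: lt_le_trans V1.
(* If the norm of phi is 0, the right side is 0 even for an infinite infimum; one admissible r, the
   midpoint of (1, P), then gives [L <= 0]. *)
rewrite lee_fin le_eqVlt => /predU1P[x0|x0].
  pose r := ((1 + P) / 2)%R.
  have P1 : (1 < P)%R.
    by rewrite -(ltr_pM2r p0) PpE mul1r ltrDr mulr_gt0// subr_gt0.
  have /LV : V (A_const r w `^ (q - s_exponent p q r)^-1 *
    ((q / s_exponent p q r) `^ (q - s_exponent p q r)^-1)%R%:E).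
    by exists r => //=; rewrite /r; apply/andP; split; lra.
  by rewrite -x0 !mule0.
(* A positive finite norm can be divided out, which leaves a lower bound for each member of [V]. *)
rewrite muleAC -EFinM -lee_pdivrMl ?mulr_gt0//.
apply: le_ereal_inf_tmp => v /LV.
by rewrite muleAC -EFinM lee_pdivrMl ?mulr_gt0.
Qed.
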